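(* Let $E,A\in\mathbb{C}^{n\times n}$ be the coefficient matrices of a descriptor system satisfying the standing assumptions listed in the context. Let $\Delta^{\mathcal A}_{11},\Delta^{\mathcal A}_{22}\in\mathbb{C}^{n\times n}$ be Hermitian, $\Delta^{\mathcal E}_{11},\Delta^{\mathcal E}_{22}\in\mathbb{C}^{n\times n}$ skew-Hermitian, and $\Delta^{\mathcal A}_{12},\Delta^{\mathcal E}_{12}\in\mathbb{C}^{n\times n}$ arbitrary, and set $A_\Delta:=A+\Delta^{\mathcal A}_{12}$, $E_\Delta:=E+\Delta^{\mathcal E}_{12}$. Consider the system of matrix equations in the unknowns $Y_{12},Y_{21}\in\mathbb{C}^{n\times n}$ \begin{align*} A_\Delta Y_{21}+Y_{21}^{\mathsf H}A_\Delta^{\mathsf H} &= -\Delta^{\mathcal A}_{11}-Y_{21}^{\mathsf H}\Delta^{\mathcal A}_{22}Y_{21},\\ E_\Delta Y_{21}-Y_{21}^{\mathsf H}E_\Delta^{\mathsf H} &= -\Delta^{\mathcal E}_{11}-Y_{21}^{\mathsf H}\Delta^{\mathcal E}_{22}Y_{21},\\ A_\Delta^{\mathsf H}Y_{12}+Y_{12}^{\mathsf H}A_\Delta &= -\Delta^{\mathcal A}_{22}-Y_{12}^{\mathsf H}\Delta^{\mathcal A}_{11}Y_{12},\\ -E_\Delta^{\mathsf H}Y_{12}+Y_{12}^{\mathsf H}E_\Delta &= -\Delta^{\mathcal E}_{22}-Y_{12}^{\mathsf H}\Delta^{\mathcal E}_{11}Y_{12}. \end{align*} Let \begin{align*} \delta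 &:= \min\{\sigma_{2n^2}(K_1(E_\Delta,A_\Delta)),\ \sigma_{2n^2}(K_2(E_\Delta,A_\Delta))\}-2\max\{\|\Delta^{\mathcal A}_{12}\|_2,\|\Delta^{\mathcal E}_{12}\|_2\},\\ \theta &:= \|(\Delta^{\mathcal E}_{11},\Delta^{\mathcal E}_{22},\Delta^{\mathcal A}_{11},\Delta^{\mathcal A}_{22})\|_F,\\ \omega &:= \sqrt{2}\,\|(\Delta^{\mathcal A}_{11},\Delta^{\mathcal A}_{22},\Delta^{\mathcal E}_{11},\Delta^{\mathcal E}_{22})\|_F. \end{align*} If $\delta>0$ and $\frac{\theta\omega}{\delta^2}<\frac14$, then there exists a solution $(Y_{12},Y_{21})$ of these four equations satisfying $$\|(Y_{12},Y_{21})\|_F\le \frac{2\theta}{\delta}.$$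
   Context: Notation: $M^{\mathsf H}$, $M^{\mathsf T}$, $\overline M$ denote conjugate transpose, transpose and entrywise complex conjugate; $\|\cdot\|_2$ is the spectral norm; $\|\cdot\|_F$ is the Frobenius norm, and for a list of matrices $\|(M_1,\dots,M_k)\|_F:=\sqrt{\sum_{i=1}^k\|M_i\|_F^2}$. $\sigma_j(M)$ is the $j$th singular value of $M$ in decreasing order, so for a $2n^2\times 2n^2$ matrix $\sigma_{2n^2}$ is the smallest one. $\otimes$ is the Kronecker product. For $F,G\in\mathbb{C}^{n\times n}$ define the $2n^2\times 2n^2$ matrices $$K_1(F,G):=\begin{bmatrix} I_n\otimes F & -\overline F\otimes I_n\\ I_n\otimes G & \overline G\otimes I_n\end{bmatrix},\qquad K_2(F,G):=\begin{bmatrix} -I_n\otimes F^{\mathsf H} & F^{\mathsf T}\otimes I_n\\ I_n\otimes G^{\mathsf H} & G^{\mathsf T}\otimes I_n\end{bmatrix}.$$ Standing assumptions: $E,A$ belong to a descriptor system $E\dot x=Ax+Bu$, $y=Cx+Du$ with $A,E\in\mathbb{C}^{n\times n}$, $B\in\mathbb{C}^{n\times m}$, $C\in\mathbb{C}^{m\times n}$, $D\in\mathbb{C}^{m\times m}$, such that $sE-A$ is regular ($\det(sE-A)\not\equiv 0$); the system is controllable ($\operatorname{rank}[\,sE-A,\ B\,]=n$ for all $s\in\mathbb{C}$) and observable ($\operatorname{rank}[\,sE^{\mathsf H}-A^{\mathsf H},\ C^{\mathsf H}\,]=n$ for all $s\in\mathbb{C}$); and the system is port-Hamiltonian with positive definite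 $E$ and $\mathcal W$, i.e. $A=J-R$, $B=G-P$, $C^{\mathsf H}=G+P$, $D=S-N$ with $$\begin{bmatrix} J & G\\ -G^{\mathsf H} & N\end{bmatrix}\ \text{skew-Hermitian},\qquad \mathcal W=\begin{bmatrix} R & P\\ P^{\mathsf H} & S\end{bmatrix}=\mathcal W^{\mathsf H}>0,\qquad E=E^{\mathsf H}>0.$$ *)

(* Defs.v *)
From mathcomp Require Import all_boot all_order all_algebra.
From mathcomp Require Import reals complex mxtens.

Set Implicit Arguments.
Unset Strict Implicit.
Unset Printing Implicit Defensive.

Import Order.TTheory GRing.Theory Num.Theory Num.Def.
Local Open Scope ring_scope.
Local Open Scope sesquilinear_scope.

(* [M^t*] is the conjugate transpose and [*t] the Kronecker product. *)

Notation skewhermmx := (hermitianmx _ true conjC).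

Section Norms.
Variable R : realType.
Local Notation C := R[i].

Definition fronorm m n (M : 'M[C]_(m, n)) : R :=
  Num.sqrt (\sum_i \sum_j Normc.normc (M i j) ^+ 2).

Definition fronorm_seq m n (s : seq 'M[C]_(m, n)) : R :=
  Num.sqrt (\sum_(M <- s) fronorm M ^+ 2).

(* The singular values of M, in decreasing order and with multiplicity.
   M^H M is Hermitian, hence normal, so [spectral_diag] does list its
   eigenvalues, which are nonnegative reals embedded in R[i]. *)
Definition singular_values n (M : 'M[C]_n) : seq R :=
  sort >=%R
    [seq Num.sqrt (complex.Re (spectral_diag (M^t* *m M) 0 i)) | i : 'I_n].

(* Indexed from 1: [sigma 1 M] is the largest and [sigma n M] the smallest. *)
Definition sigma n (j : nat) (M : 'M[C]_n) : R :=
  nth 0 (singular_values M) j.-1.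

Definition specnorm n (M : 'M[C]_n) : R := sigma 1 M.

End Norms.

Section Kronecker.
Variables (R : realType) (n : nat).
Local Notation C := R[i].
Implicit Types F G : 'M[C]_n.

Definition K1 F G : 'M[C]_(n * n + n * n) :=
  block_mx (1%:M *t F) (- (map_mx conjC F *t 1%:M))
           (1%:M *t G) (map_mx conjC G *t 1%:M).

Definition K2 F G : 'M[C]_(n * n + n * n) :=
  block_mx (- (1%:M *t F^t*)) (F^T *t 1%:M)
           (1%:M *t G^t*)     (G^T *t 1%:M).

End Kronecker.

Section DescriptorSystem.
Variable R : realType.
Local Notation C := R[i].

Definition posdefmx n (M : 'M[C]_n) : Prop :=
  M \is hermsymmx /\ forall x : 'cV[C]_n, x != 0 -> 0 < (x^t* *m M *m x) 0 0.

Definition regular_pencil n (E A : 'M[C]_n) : Prop :=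
  exists s : C, \det (s *: E - A) != 0.

Definition controllable n m (E A : 'M[C]_n) (B : 'M[C]_(n, m)) : Prop :=
  forall s : C, \rank (row_mx (s *: E - A) B) = n.

Definition observable n m (E A : 'M[C]_n) (Cm : 'M[C]_(m, n)) : Prop :=
  forall s : C, \rank (row_mx (s *: E^t* - A^t*) (Cm^t*)) = n.

Definition port_hamiltonian n m (E A : 'M[C]_n) (B : 'M[C]_(n, m))
    (Cm : 'M[C]_(m, n)) (D : 'M[C]_m) : Prop :=
  exists (J Rd : 'M[C]_n) (G P : 'M[C]_(n, m)) (S N : 'M[C]_m),
    [/\ [/\ A = J - Rd, B = G - P, Cm^t* = G + P & D = S - N],
        block_mx J G (- G^t*) N \is skewhermmx,
        posdefmx (block_mx Rd P (P^t*) S) &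
        posdefmx E].

Definition standing_assumptions n m (E A : 'M[C]_n) (B : 'M[C]_(n, m))
    (Cm : 'M[C]_(m, n)) (D : 'M[C]_m) : Prop :=
  [/\ regular_pencil E A, controllable E A B, observable E A Cm &
      port_hamiltonian E A B Cm D].

End DescriptorSystem.

(* Main.v *)
Require Import Defs.
From mathcomp Require Import all_boot all_order all_algebra.
From mathcomp Require Import classical_sets reals complex mxtens ring lra.

(** The four equations decouple: the first two involve only [Y21], the last two
    only [Y12]. Writing ^H for the adjoint, each pair has the form

      F Y - Y^H F^H = - S0 - Y^H S1 Y,    G Y + Y^H G^H = - H0 - Y^H H1 Y

    with [S0], [S1] skew-Hermitian and [H0], [H1] Hermitian; for [Y21] the
    pencil is [F = ED], [G = AD], for [Y12] it is the adjoint one,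
    [F = - ED^H] and [G = AD^H], and [K2 ED AD] is [K1] of that adjoint pencil
    ([K2_K1]).

    Up to vectorization, [K1 F G] sends a pair [(Y, Z)] to
    [(F Y - Z F^H, G Y + Z G^H)], so the linear part above is [K1 F G] at
    [(Y, Y^H)]. A positive lower bound [s] on its smallest singular value
    ([sigma_last_mulmx]) makes [K1 F G] invertible ([lower_bound_unitmx]); by
    uniqueness the solution of the linear system with a skew-Hermitian and a
    Hermitian right-hand side satisfies [Z = Y^H] ([sylvester_pair_solveP]).
    The linear part expands the Frobenius norm by at least [sqrt 2 * s]
    ([sylvester_pair_lower_bound]).

    The quadratic equations are then a fixed-point problem for a map of
    'M[C]_n, which is a contraction of the ball of radius [sqrt 2 * t / s] as
    soon as [2 t^2 < s^2], where [t] bounds the norms of [(S0, H0)] and of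
    [(S1, H1)] ([quadratic_pair_solution]). It applies with [t = theta] and
    [s = delta], which is at most each of the two smallest singular values;
    since [omega = sqrt 2 * theta], the smallness hypothesis reads
    [sqrt 2 * theta^2 < delta^2 / 4] and implies [2 theta^2 < delta^2]. The pair
    of the two solutions has norm at most [sqrt 2] times the common radius,
    which is [2 theta / delta]. *)

Import Order.TTheory GRing.Theory Num.Theory Num.Def.
Local Open Scope ring_scope.
Local Open Scope sesquilinear_scope.

(** * The Frobenius norm *)

(** Lagrange's identity: the difference of the two sides is half of a double
    sum of squares. *)
Lemma cauchy_schwarz_sum (R : realFieldType) (I : finType) (a b : I -> R) :
  (\sum_i a i * b i) ^+ 2 <= (\sum_i a i ^+ 2) * (\sum_i b i ^+ 2).
Proof.
have lagrange : \sum_i \sum_j (a i * b j - a j * b i) ^+ 2 =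
  2 * ((\sum_i a i ^+ 2) * (\sum_i b i ^+ 2) - (\sum_i a i * b i) ^+ 2).
  transitivity (\sum_i \sum_j ((a i ^+ 2 * b j ^+ 2 + b i ^+ 2 * a j ^+ 2)
      - 2 * ((a i * b i) * (a j * b j)))).
    by apply: eq_bigr => i _; apply: eq_bigr => j _; ring.
  under eq_bigr do rewrite big_split sumrN -mulr_sumr big_split /= -!mulr_sumr.
  rewrite big_split sumrN -mulr_sumr big_split /= -!mulr_suml; ring.
have : 0 <= \sum_i \sum_j (a i * b j - a j * b i) ^+ 2.
  by do 2![apply: sumr_ge0 => ? _]; apply: sqr_ge0.
by rewrite lagrange; lra.
Qed.

Section FrobeniusNorm.
Set Implicit Arguments.
Unset Strict Implicit.
Variable R : realType.
Local Notation C := R[i].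
Local Notation nrm := (@Normc.normc R).

Lemma normc_ge0 (z : C) : 0 <= nrm z.
Proof. by case: z => x y; apply: sqrtr_ge0. Qed.

Lemma sqr_normc_real (z : C) : ((nrm z ^+ 2)%:C)%C = z^* * z.
Proof. by rewrite -normCKC rmorphXn /=; case: z. Qed.

Lemma normc_conj (z : C) : nrm z^* = nrm z.
Proof.
have : (((nrm z^*)%:C) = ((nrm z)%:C))%C by apply: norm_conjC.
by case.
Qed.

Lemma Re_le_normc (z : C) : `|complex.Re z| <= nrm z.
Proof. by have := normc_ge_Re z; rewrite lecR; case: z. Qed.

Lemma Im_le_normc (z : C) : `|complex.Im z| <= nrm z.
Proof.
case: z => x y /=; rewrite -sqrtr_sqr ler_wsqrtr // lerDr; exact: sqr_ge0.
Qed.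

Lemma normc_le_ReIm (z : C) : nrm z <= `|complex.Re z| + `|complex.Im z|.
Proof.
case: z => x y /=.
have <- : Num.sqrt ((`|x| + `|y|) ^+ 2) = `|x| + `|y|.
  by rewrite sqrtr_sqr ger0_norm // addr_ge0.
rewrite ler_wsqrtr // sqrrD !real_normK ?num_real // [leRHS]addrAC lerDl.
by rewrite mulrn_wge0 ?mulr_ge0.
Qed.

Lemma normcD (x y : C) : nrm (x + y) <= nrm x + nrm y.
Proof. exact: le_normcD. Qed.

Lemma normc_sum_le (I : finType) (F : I -> C) :
  nrm (\sum_i F i) <= \sum_i nrm (F i).
Proof.
elim/big_ind2: _ => //[|x z y w hx hy]; first by rewrite Normc.normc0.
by apply: le_trans (normcD z w) _; apply: lerD.
Qed.

Lemma fronorm_ge0 m n (M : 'M[C]_(m, n)) : 0 <= fronorm M.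
Proof. exact: sqrtr_ge0. Qed.

Lemma sqr_fronorm m n (M : 'M[C]_(m, n)) :
  fronorm M ^+ 2 = \sum_i \sum_j nrm (M i j) ^+ 2.
Proof.
by rewrite sqr_sqrtr //; do 2![apply: sumr_ge0 => ? _]; apply: sqr_ge0.
Qed.

Lemma fronorm_sqr_le m n (M : 'M[C]_(m, n)) (x : R) :
  0 <= x -> fronorm M ^+ 2 <= x ^+ 2 -> fronorm M <= x.
Proof. by move=> x0; rewrite ler_sqr ?nnegrE ?fronorm_ge0. Qed.

Lemma normc_le_fronorm m n (M : 'M[C]_(m, n)) i j : nrm (M i j) <= fronorm M.
Proof.
rewrite -ler_sqr ?nnegrE ?normc_ge0 ?fronorm_ge0 // sqr_fronorm.
have ge0 k l : 0 <= nrm (M k l) ^+ 2 by apply: sqr_ge0.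
rewrite (bigD1 i) //= (bigD1 j) //= -addrA lerDl addr_ge0 ?sumr_ge0 //.
by move=> k _; apply: sumr_ge0.
Qed.

(** Together with [normc_le_fronorm], this reduces convergence in the Frobenius
    norm to convergence of each entry. *)
Lemma fronorm_le_sum m n (M : 'M[C]_(m, n)) :
  fronorm M <= \sum_i \sum_j nrm (M i j).
Proof.
rewrite pair_big /=; set S := \sum_p _.
have le_S p : nrm (M p.1 p.2) <= S.
  by rewrite /S (bigD1 p) //= lerDl sumr_ge0 // => *; apply: normc_ge0.
have S0 : 0 <= S by apply: sumr_ge0 => *; apply: normc_ge0.
apply: fronorm_sqr_le => //; rewrite sqr_fronorm pair_big /= [leRHS]expr2 {1}/S.
rewrite mulr_suml; apply: ler_sum => p _.
by rewrite expr2 ler_wpM2l // normc_ge0.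
Qed.

Lemma fronorm0_eq0 m n (M : 'M[C]_(m, n)) : fronorm M <= 0 -> M = 0.
Proof.
move=> M0; apply/matrixP => i j; rewrite mxE; apply: Normc.eq0_normc.
by apply/eqP; rewrite eq_le normc_ge0 (le_trans (normc_le_fronorm _ _ _)).
Qed.

Lemma fronorm0 m n : fronorm (0 : 'M[C]_(m, n)) = 0.
Proof.
rewrite /fronorm big1 ?sqrtr0 // => i _; apply: big1 => j _.
by rewrite mxE Normc.normc0 expr0n.
Qed.

Lemma fronormN m n (M : 'M[C]_(m, n)) : fronorm (- M) = fronorm M.
Proof.
congr Num.sqrt; apply: eq_bigr => i _; apply: eq_bigr => j _.
by rewrite mxE normcN.
Qed.

Lemma adjM m n p (A : 'M[C]_(m, n)) (B : 'M[C]_(n, p)) :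
  (A *m B)^t* = B^t* *m A^t*.
Proof. by rewrite trmx_mul map_mxM. Qed.

Lemma adjD m n (A B : 'M[C]_(m, n)) : (A + B)^t* = A^t* + B^t*.
Proof. by rewrite linearD map_mxD. Qed.

Lemma adjN m n (A : 'M[C]_(m, n)) : (- A)^t* = - A^t*.
Proof. by rewrite linearN map_mxN. Qed.

Lemma fronorm_adj m n (M : 'M[C]_(m, n)) : fronorm (M^t*) = fronorm M.
Proof.
rewrite /fronorm exchange_big /=; congr Num.sqrt.
by apply: eq_bigr => i _; apply: eq_bigr => j _; rewrite !mxE normc_conj.
Qed.

Lemma fronormD m n (M N : 'M[C]_(m, n)) :
  fronorm (M + N) <= fronorm M + fronorm N.
Proof.
apply: fronorm_sqr_le; first by rewrite addr_ge0 ?fronorm_ge0.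
have cs : \sum_p nrm (M p.1 p.2) * nrm (N p.1 p.2) <= fronorm M * fronorm N.
  rewrite -ler_sqr ?nnegrE ?mulr_ge0 ?fronorm_ge0 //; last first.
    by apply: sumr_ge0 => *; rewrite mulr_ge0 ?normc_ge0.
  rewrite exprMn !sqr_fronorm !pair_big /=; exact: cauchy_schwarz_sum.
have -> : (fronorm M + fronorm N) ^+ 2 =
  fronorm M ^+ 2 + fronorm N ^+ 2 + 2 * (fronorm M * fronorm N) by ring.
apply: le_trans (_ : _ <= fronorm M ^+ 2 + fronorm N ^+ 2
  + 2 * \sum_p nrm (M p.1 p.2) * nrm (N p.1 p.2)) _; last by lra.
rewrite !sqr_fronorm !pair_big /= mulr_sumr -!big_split /=.
apply: ler_sum => -[i j] _ /=.
have -> : nrm (M i j) ^+ 2 + nrm (N i j) ^+ 2 + 2 * (nrm (M i j) * nrm (N i j))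
  = (nrm (M i j) + nrm (N i j)) ^+ 2 by ring.
by rewrite mxE ler_sqr ?nnegrE ?addr_ge0 ?normc_ge0 // normcD.
Qed.

Lemma fronormB_le m n (M N : 'M[C]_(m, n)) :
  fronorm (M - N) <= fronorm M + fronorm N.
Proof. by rewrite -(fronormN N) fronormD. Qed.

Lemma fronormM m n p (M : 'M[C]_(m, n)) (N : 'M[C]_(n, p)) :
  fronorm (M *m N) <= fronorm M * fronorm N.
Proof.
apply: fronorm_sqr_le; first by rewrite mulr_ge0 ?fronorm_ge0.
rewrite exprMn !sqr_fronorm mulr_suml; apply: ler_sum => i _.
rewrite [X in _ * X]exchange_big mulr_sumr; apply: ler_sum => j _ /=.
apply: le_trans (cauchy_schwarz_sum _ _ _ _).
rewrite ler_sqr ?nnegrE ?normc_ge0 //; last first.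
  by apply: sumr_ge0 => k _; rewrite mulr_ge0 ?normc_ge0.
rewrite mxE; apply: le_trans (normc_sum_le _) _.
by apply: ler_sum => k _; rewrite Normc.normcM.
Qed.

Lemma sqr_fronorm_col_mx m1 m2 n (M : 'M[C]_(m1, n)) (N : 'M[C]_(m2, n)) :
  fronorm (col_mx M N) ^+ 2 = fronorm M ^+ 2 + fronorm N ^+ 2.
Proof.
rewrite !sqr_fronorm big_split_ord /=; congr (_ + _).
  by under eq_bigr do under eq_bigr do rewrite col_mxEu.
by under eq_bigr do under eq_bigr do rewrite col_mxEd.
Qed.

(** A pair of matrices is represented by the block column [col_mx S H], whose
    Frobenius norm is that of the pair. The quadratic terms of the two coupled
    equations are of this form, with the same outer factors. *)
Lemma fronorm_sandwich m n p q (Y : 'M[C]_(m, n)) (S H : 'M[C]_(n, p))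
    (W : 'M[C]_(p, q)) :
  fronorm (col_mx (Y *m S *m W) (Y *m H *m W)) <=
  fronorm Y * fronorm (col_mx S H) * fronorm W.
Proof.
apply: fronorm_sqr_le; first by rewrite !mulr_ge0 ?fronorm_ge0.
have bound (M : 'M[C]_(n, p)) : fronorm (Y *m M *m W) ^+ 2
    <= fronorm Y ^+ 2 * fronorm M ^+ 2 * fronorm W ^+ 2.
  rewrite -!exprMn ler_sqr ?nnegrE ?mulr_ge0 ?fronorm_ge0 //.
  apply: le_trans (fronormM _ _) _.
  by rewrite ler_wpM2r ?fronorm_ge0 // fronormM.
rewrite !exprMn !sqr_fronorm_col_mx mulrDr mulrDl; exact: lerD.
Qed.

(** Turns statements about norms of column vectors into matrix algebra, where
    unitary factors cancel and a spectral decomposition can be substituted. *)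
Lemma sqr_fronorm_col n (v : 'cV[C]_n) :
  ((fronorm v ^+ 2)%:C)%C = (v^t* *m v) 0 0.
Proof.
rewrite sqr_fronorm rmorph_sum mxE; apply: eq_bigr => i _ /=.
by rewrite big_ord1 sqr_normc_real !mxE.
Qed.

End FrobeniusNorm.

(** * Contractions of balls of matrices *)

Section Contraction.
Variable R : realType.
Local Notation C := R[i].
Local Notation nrm := (@Normc.normc R).

Set Implicit Arguments.
Unset Strict Implicit.

(** The set of the [t] with [t <= c q^k] for every [k] is stable under division
    by [q]; were it to contain a positive number, its supremum would be
    positive and at most [q] times itself. *)
Lemma le0_geometric (x c q : R) :
  0 <= q < 1 -> (forall k, x <= c * q ^+ k) -> x <= 0.
Proof.
move=> /andP[q0 q1] x_le; rewrite leNgt; apply/negP => x0.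
have q_gt0 : 0 < q.
  rewrite lt_neqAle q0 andbT; apply/eqP => q00.
  by have := x_le 1%N; rewrite -q00 mulr0 leNgt x0.
pose S := [set t : R | forall k, t <= c * q ^+ k]%classic.
have S_ub : has_ubound S by exists c => t /(_ 0%N); rewrite mulr1.
have S_x : S x by [].
have le_sup t : S t -> t <= sup S by move=> St; apply: ub_le_sup.
have : sup S <= q * sup S.
  apply: ge_sup; first by exists x.
  move=> t St; rewrite -ler_pdivrMl //; apply: le_sup => k.
  by rewrite ler_pdivrMl // mulrCA -exprS.
have : 0 < sup S by apply: lt_le_trans x0 (le_sup _ S_x).
by rewrite -[leLHS]mul1r => s0; rewrite ler_pM2r // leNgt q1.
Qed.

(** The intervals centred at [u k] with radius [c q^k / (1 - q)] are nested,
    because consecutive radii differ by exactly [c q^k]. The supremum of their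
    left endpoints therefore lies in all of them. *)
Lemma geometric_limit (u : nat -> R) (c q : R) : 0 <= q < 1 ->
  (forall k, `|u k.+1 - u k| <= c * q ^+ k) ->
  exists l, forall k, `|l - u k| <= c / (1 - q) * q ^+ k.
Proof.
move=> /andP[q0 q1] u_step; set a := c / (1 - q).
have q1' : 0 < 1 - q by rewrite subr_gt0.
have c0 : 0 <= c by have := le_trans (normr_ge0 _) (u_step 0%N); rewrite mulr1.
have aE : a - a * q = c by rewrite /a; field; rewrite gt_eqF.
have e_ge0 k : 0 <= a * q ^+ k.
  by rewrite mulr_ge0 ?exprn_ge0 // divr_ge0 // ltW.
have e_step k : a * q ^+ k - a * q ^+ k.+1 = c * q ^+ k.
  by rewrite exprS -aE; ring.
pose lo k := u k - a * q ^+ k; pose hi k := u k + a * q ^+ k.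
have lo_mono : {homo lo : i j / (i <= j)%N >-> i <= j}.
  apply: homo_leq => [//|? ? ?|k]; first exact: le_trans.
  by have := u_step k; have := e_step k; rewrite ler_norml /lo => ?; lra.
have hi_mono : {homo hi : i j / (i <= j)%N >-> j <= i}.
  apply: homo_leq => [//|y x z xy yz|k]; first exact: le_trans yz xy.
  by have := u_step k; have := e_step k; rewrite ler_norml /hi => ?; lra.
have lo_hi i j : lo i <= hi j.
  have : lo (maxn i j) <= hi (maxn i j).
    by have := e_ge0 (maxn i j); rewrite /lo /hi; lra.
  have := lo_mono _ _ (leq_maxl i j); have := hi_mono _ _ (leq_maxr i j); lra.
exists (sup (range lo)) => k.
have : lo k <= sup (range lo).
  by apply: ub_le_sup; [exists (hi 0%N) => _ [i _ <-]| exists k].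
have : sup (range lo) <= hi k.
  by apply: ge_sup; [exists (lo 0%N); exists 0%N | move=> _ [i _ <-]].
by rewrite ler_norml /lo /hi; lra.
Qed.

(** The part of the completeness of the space of complex matrices that a
    fixed-point iteration needs, with an explicit rate of convergence. The
    limit is taken separately in the real and imaginary part of each entry. *)
Lemma fronorm_geometric_limit m n (X : nat -> 'M[C]_(m, n)) (c q : R) :
  0 <= q < 1 -> (forall k, fronorm (X k.+1 - X k) <= c * q ^+ k) ->
  exists L b, forall k, fronorm (L - X k) <= b * q ^+ k.
Proof.
move=> q01 X_step; pose a := c / (1 - q).
have entry_limit i j : exists z, forall k,
    nrm (z - X k i j) <= (a + a) * q ^+ k.
  have [k|x x_lim] := @geometric_limit (fun k => complex.Re (X k i j)) c q q01.
    apply: le_trans (X_step k); apply: le_trans (normc_le_fronorm _ i j).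
    by apply: le_trans (Re_le_normc _); rewrite !mxE !raddfB.
  have [k|y y_lim] := @geometric_limit (fun k => complex.Im (X k i j)) c q q01.
    apply: le_trans (X_step k); apply: le_trans (normc_le_fronorm _ i j).
    by apply: le_trans (Im_le_normc _); rewrite !mxE !raddfB.
  exists (Complex x y) => k; apply: le_trans (normc_le_ReIm _) _.
  move: (x_lim k) (y_lim k); case: (X k i j) => x' y' /= *.
  by rewrite mulrDl lerD.
have /fin_all_exists[F F_lim] i := fin_all_exists (entry_limit i).
exists (\matrix_(i, j) F i j), (\sum_(i < m) \sum_(j < n) (a + a)) => k.
apply: le_trans (fronorm_le_sum _) _; rewrite mulr_suml.
apply: ler_sum => i _; rewrite mulr_suml; apply: ler_sum => j _.
by rewrite !mxE.
Qed.

(** Banach's fixed-point theorem on a closed ball for the Frobenius norm: the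
    iterates from [0] move by geometrically decreasing steps, and the norm of
    [f L - L], like the excess of [fronorm L] over [r], is dominated by a
    geometric sequence. *)
Lemma contraction_fixpoint m n (f : 'M[C]_(m, n) -> 'M[C]_(m, n)) (r q : R) :
  0 <= r -> 0 <= q < 1 ->
  (forall X, fronorm X <= r -> fronorm (f X) <= r) ->
  (forall X Y, fronorm X <= r -> fronorm Y <= r ->
     fronorm (f X - f Y) <= q * fronorm (X - Y)) ->
  exists2 X, fronorm X <= r & f X = X.
Proof.
move=> r0 q01 f_ball f_contr; pose X k := iter k f 0.
have q0 : 0 <= q by case/andP: q01.
have X_ball k : fronorm (X k) <= r.
  by elim: k => [|k IH] /=; [rewrite fronorm0 | apply: f_ball].
have X_step k : fronorm (X k.+1 - X k) <= fronorm (X 1%N - X 0%N) * q ^+ k.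
  elim: k => [|k IH]; first by rewrite mulr1.
  apply: le_trans (f_contr _ _ (X_ball k.+1) (X_ball k)) _.
  by rewrite exprS mulrCA ler_wpM2l.
have [L [b L_lim]] := fronorm_geometric_limit q01 X_step.
have L_ball : fronorm L <= r.
  rewrite -subr_le0; apply: (le0_geometric (c := b) q01) => k.
  have := fronormD (L - X k) (X k); rewrite subrK.
  by have := L_lim k; have := X_ball k; lra.
exists L => //; apply/subr0_eq/fronorm0_eq0.
apply: (le0_geometric (c := (q + q) * b) q01) => k.
have := fronormB_le (f L - X k.+1) (L - X k.+1); rewrite opprB addrA subrK.
have := f_contr _ _ L_ball (X_ball k); rewrite -[f (X k)]/(X k.+1).
have := L_lim k.+1; have := ler_wpM2l q0 (L_lim k); rewrite exprS.
by have -> : (q + q) * b * q ^+ k = q * (b * q ^+ k) + b * (q * q ^+ k);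
  [ring | lra].
Qed.

End Contraction.

(** * The smallest singular value *)

Section SingularValues.
Variable R : realType.
Local Notation C := R[i].
Local Notation nrm := (@Normc.normc R).

Set Implicit Arguments.
Unset Strict Implicit.

Lemma size_singular_values n (M : 'M[C]_n) : size (singular_values M) = n.
Proof. by rewrite size_sort size_map size_enum_ord. Qed.

Lemma specnorm_ge0 n (M : 'M[C]_n) : 0 <= specnorm M.
Proof.
have [lt_n|ge_n] := ltnP 0 (size (singular_values M)); last first.
  by rewrite /specnorm /sigma nth_default.
have := mem_nth 0 lt_n; rewrite mem_sort => /mapP[i _ sE].
by rewrite /specnorm /sigma [X in 0 <= X]sE sqrtr_ge0.
Qed.

Lemma sigma_last_le n (M : 'M[C]_n) i :
  sigma n M <= Num.sqrt (complex.Re (spectral_diag (M^t* *m M) 0 i)).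
Proof.
set x := Num.sqrt _.
have x_sv : x \in singular_values M.
  by rewrite mem_sort; apply/mapP; exists i; rewrite ?mem_enum.
have sorted_sv : sorted >=%R (singular_values M).
  by apply: sort_sorted => y z; apply: ge_total.
have n0 : (0 < n)%N by case: n i {x x_sv sorted_sv} M => [[]|].
rewrite -[leRHS](nth_index 0 x_sv) /sigma.
apply: (sorted_leq_nth ge_trans ge_refl 0 sorted_sv).
- by rewrite inE index_mem.
- by rewrite inE size_singular_values prednK.
by rewrite -ltnS prednK // -[ltnRHS](size_singular_values M) index_mem.
Qed.

(** With [A] the Gram matrix of [M], the squared norm of [M v] is the value at
    [v] of the Hermitian form [A]; in an orthonormal eigenbasis it is a
    combination of squared coordinates weighted by the eigenvalues of [A], none
    of which is less than the square of the smallest singular value. *)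
Lemma sigma_last_mulmx n (M : 'M[C]_n) (v : 'cV[C]_n) :
  sigma n M * fronorm v <= fronorm (M *m v).
Proof.
have [s_le0|s_gt0] := lerP (sigma n M) 0.
  by apply: le_trans (fronorm_ge0 _); rewrite mulr_le0_ge0 ?fronorm_ge0.
have s_ge0 := ltW s_gt0.
rewrite -ler_sqr ?nnegrE ?mulr_ge0 ?fronorm_ge0 // exprMn.
set A := M^t* *m M; set P := spectralmx A; set d := spectral_diag A.
have P_unitary : P \is unitarymx := spectral_unitarymx A.
have A_normal : A \is normalmx.
  apply: hermitian_normalmx; apply/is_hermitianmxP.
  by rewrite expr0 scale1r adjM trmxCK.
have AE : A = P^t* *m diag_mx d *m P.
  by rewrite -invmx_unitary //; apply/orthomx_spectralP.
(* The coordinates of [v] in the eigenbasis are the entries of [P *m v]. *)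
have -> : fronorm v ^+ 2 = fronorm (P *m v) ^+ 2.
  apply: (@complexI R); rewrite !sqr_fronorm_col adjM mulmxA.
  by rewrite mulmxKtV.
have Mv_sqr : fronorm (M *m v) ^+ 2 =
    \sum_i complex.Re (d 0 i) * nrm ((P *m v) i 0) ^+ 2.
  have : ((fronorm (M *m v) ^+ 2)%:C)%C
      = \sum_i d 0 i * ((nrm ((P *m v) i 0) ^+ 2)%:C)%C.
    rewrite sqr_fronorm_col adjM mulmxA -[_ *m _ *m M]mulmxA -/A AE.
    rewrite !mulmxA -adjM -[_ *m P *m v]mulmxA mxE; apply: eq_bigr => i _.
    by rewrite mul_mx_diag !mxE mulrAC sqr_normc_real mulrC.
  move/(congr1 (@complex.Re R)) => /= ->; rewrite raddf_sum.
  by apply: eq_bigr => i _; case: (d 0 i) => a b /=; rewrite mulr0 subr0.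
rewrite [leRHS]Mv_sqr sqr_fronorm mulr_sumr; apply: ler_sum => i _.
rewrite big_ord1 ler_wpM2r ?sqr_ge0 //.
have s_le := sigma_last_le M i; have sqrt_gt0 := lt_le_trans s_gt0 s_le.
(* A positive square root certifies that the eigenvalue itself is positive. *)
rewrite -[leRHS]sqr_sqrtr; last by rewrite ltW // -sqrtr_gt0.
by rewrite ler_sqr ?nnegrE ?sqrtr_ge0 // ltW.
Qed.

Lemma lower_bound_unitmx N (M : 'M[C]_N) (s : R) : 0 < s ->
  (forall v : 'cV_N, s * fronorm v <= fronorm (M *m v)) -> M \in unitmx.
Proof.
move=> s0 M_lb; rewrite -unitmx_tr -row_free_unit.
apply: inj_row_free => v vM0; apply: trmx_inj; rewrite trmx0.
apply: fronorm0_eq0.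
have := M_lb v^T; rewrite -[M *m _]trmxK trmx_mul trmxK vM0 !trmx0 fronorm0.
by rewrite pmulr_rle0.
Qed.

End SingularValues.

(** * A pair of coupled Sylvester equations and its quadratic perturbation *)

Section SylvesterPair.
Variables (R : realType) (n : nat).
Local Notation C := R[i].

Set Implicit Arguments.
Unset Strict Implicit.

(** Columns are stacked: the outer index of the pair is the column of [Y], so
    that the Kronecker product acts by [Y |-> B *m Y *m A^T] in
    [tensmx_colvec]. *)
Definition colvec (Y : 'M[C]_n) : 'cV[C]_(n * n) :=
  \col_k Y (mxtens_unindex k).2 (mxtens_unindex k).1.

Definition uncolvec (v : 'cV[C]_(n * n)) : 'M[C]_n :=
  \matrix_(i, j) v (mxtens_index (j, i)) 0.

Lemma uncolvecK v : colvec (uncolvec v) = v.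
Proof.
apply/colP => k; rewrite !mxE -[RHS](congr1 (v^~ 0) (mxtens_unindexK k)).
by case: mxtens_unindex.
Qed.

Lemma colvecK Y : uncolvec (colvec Y) = Y.
Proof. by apply/matrixP => i j; rewrite !mxE mxtens_indexK. Qed.

Lemma fronorm_colvec Y : fronorm (colvec Y) = fronorm Y.
Proof.
rewrite /fronorm [in RHS]exchange_big [in RHS]pair_big /=.
rewrite (reindex (@mxtens_index n n)) /=.
  congr Num.sqrt; apply: eq_bigr => -[i j] _.
  by rewrite big_ord1 mxE mxtens_indexK.
exact: (onW_bij _ (Bijective (@mxtens_indexK n n) (@mxtens_unindexK n n))).
Qed.

Lemma tensmx_colvec (A B Y : 'M[C]_n) :
  (A *t B) *m colvec Y = colvec (B *m Y *m A^T).
Proof.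
apply/colP => k; case: (mxtens_indexP k) => i j.
rewrite !mxE mxtens_indexK /= (reindex (@mxtens_index n n)) /=; last first.
  exact: (onW_bij _ (Bijective (@mxtens_indexK n n) (@mxtens_unindexK n n))).
under [RHS]eq_bigr do rewrite mxE mulr_suml.
rewrite pair_big; apply: eq_bigr => -[i' j'] _ /=.
by rewrite !mxE !mxtens_indexK /=; ring.
Qed.

Lemma colvecD Y Z : colvec (Y + Z) = colvec Y + colvec Z.
Proof. by apply/colP => k; rewrite !mxE. Qed.

Lemma colvecN Y : colvec (- Y) = - colvec Y.
Proof. by apply/colP => k; rewrite !mxE. Qed.

(** [K1 F G] is the matrix of a complex-linear map of a pair [(Y, Z)] of
    independent unknowns. The two equations are its restriction to the real
    subspace where [Z] is the conjugate transpose of [Y]. *)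
Lemma K1_colvec (F G Y Z : 'M[C]_n) :
  K1 F G *m col_mx (colvec Y) (colvec Z) =
  col_mx (colvec (F *m Y - Z *m F^t*)) (colvec (G *m Y + Z *m G^t*)).
Proof.
rewrite mul_block_col mulNmx !tensmx_colvec !trmx1 !mulmx1 !mul1mx.
by rewrite !map_trmx !colvecD colvecN.
Qed.

(** This identity lets the equations for [Y12] be treated as those for [Y21],
    with the pencil replaced by its adjoint. *)
Lemma K2_K1 (F G : 'M[C]_n) : K2 F G = K1 (- F^t*) (G^t*).
Proof.
have conjT (M : 'M[C]_n) : map_mx conjC (M^t*) = M^T.
  by apply/matrixP => i j; rewrite !mxE conjCK.
rewrite /K2 /K1 map_mxN !conjT; congr block_mx.
  by apply/matrixP => i j; rewrite !mxE mulrN.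
by apply/matrixP => i j; rewrite !mxE mulNr opprK.
Qed.

Definition sylvester_pair (F G Y : 'M[C]_n) : 'M[C]_(n + n, n) :=
  col_mx (F *m Y - Y^t* *m F^t*) (G *m Y + Y^t* *m G^t*).

(** The factor [sqrt 2] appears because [Y] and its adjoint both contribute to
    the norm of the vector to which [K1 F G] is applied. *)
Lemma sylvester_pair_lower_bound (F G : 'M[C]_n) (s : R) : 0 <= s ->
  (forall v : 'cV_(n * n + n * n),
     s * fronorm v <= fronorm (K1 F G *m v)) ->
  forall Y, Num.sqrt 2 * s * fronorm Y <= fronorm (sylvester_pair F G Y).
Proof.
move=> s0 K1_lb Y; have lb := K1_lb (col_mx (colvec Y) (colvec (Y^t*))).
rewrite K1_colvec -ler_sqr ?nnegrE ?mulr_ge0 ?fronorm_ge0 // in lb.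
rewrite -ler_sqr ?nnegrE ?mulr_ge0 ?fronorm_ge0 ?sqrtr_ge0 //.
move: lb; rewrite !exprMn !sqr_fronorm_col_mx !fronorm_colvec fronorm_adj.
by rewrite (@sqr_sqrtr _ 2) //; lra.
Qed.

Lemma sylvester_pairB (F G Y W : 'M[C]_n) :
  sylvester_pair F G (Y - W) = sylvester_pair F G Y - sylvester_pair F G W.
Proof.
rewrite /sylvester_pair adjD adjN opp_col_mx add_col_mx !mulmxBr !mulmxBl.
congr col_mx; last by rewrite opprD addrACA.
by rewrite !opprB [LHS]addrACA [RHS]addrACA [X in _ + X = _]addrC.
Qed.

Definition sylvester_pair_solve (F G S H : 'M[C]_n) : 'M[C]_n :=
  uncolvec (usubmx (invmx (K1 F G) *m col_mx (colvec S) (colvec H))).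

(** If [(Y, Z)] solves the complex-linear system, taking adjoints of the two
    equations shows that the pair of adjoints of [Z] and [Y] solves it too,
    because [S] is skew-Hermitian and [H] Hermitian. Uniqueness forces [Z] to
    be the adjoint of [Y]. *)
Lemma sylvester_pair_solveP (F G S H : 'M[C]_n) :
  K1 F G \in unitmx -> S^t* = - S -> H^t* = H ->
  sylvester_pair F G (sylvester_pair_solve F G S H) = col_mx S H.
Proof.
move=> K1_unit S_skew H_herm; pose w := col_mx (colvec S) (colvec H).
set Y := sylvester_pair_solve _ _ _ _.
pose Z := uncolvec (dsubmx (invmx (K1 F G) *m w)).
have YZ_sol : K1 F G *m col_mx (colvec Y) (colvec Z) = w.
  by rewrite !uncolvecK vsubmxK mulKVmx.
have colvec_inj : injective colvec := can_inj colvecK.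
have [SE HE] : F *m Y - Z *m F^t* = S /\ G *m Y + Z *m G^t* = H.
  by move: YZ_sol; rewrite K1_colvec => /eq_col_mx[/colvec_inj-> /colvec_inj->].
have : col_mx (colvec (Z^t*)) (colvec (Y^t*)) = col_mx (colvec Y) (colvec Z).
  apply: (can_inj (mulKmx K1_unit)); rewrite YZ_sol K1_colvec /w.
  rewrite -[S]opprK -S_skew -H_herm -SE -HE !adjD !adjN !adjM !trmxCK.
  by rewrite opprB [G *m _ + _]addrC.
by move=> /eq_col_mx[_ /colvec_inj YZ]; rewrite /sylvester_pair YZ SE HE.
Qed.

(** Splits the increment of the quadratic term into two sandwiches, each linear
    in [Y - W]. *)
Lemma quadratic_diff (A B Y W : 'M[C]_n) :
  (- A - Y^t* *m B *m Y) - (- A - W^t* *m B *m W) =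
  - (Y^t* *m B *m (Y - W)) - ((Y - W)^t* *m B *m W).
Proof.
have telescope (V : zmodType) (a b c d : V) :
    (- a - b) - (- a - c) = - (b - d) - (d - c).
  have cancel (x y z : V) : x - y + (z - x) = z - y.
    by rewrite [z - x]addrC addrACA subrr add0r addrC.
  by rewrite !opprB !cancel.
by rewrite adjD adjN mulmxBr !mulmxBl; apply: telescope.
Qed.

(** The solutions are the fixed points of the map [f] sending [Y] to the
    solution of the linear system whose right-hand side is the quadratic
    expression in [Y]. With [k = sqrt 2 * s] the lower bound of the linear
    part, [k * fronorm (f Y)] is at most [t + t * fronorm Y ^+ 2]. The radius
    [r] is chosen so that [k * r = 2 * t]; on the ball of radius [r < 1] this
    is at most [2 * t], hence [f] preserves the ball, and [f] contracts it by
    the factor [2 * t * r / k = r ^+ 2]. *)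
Lemma quadratic_pair_solution (F G S0 S1 H0 H1 : 'M[C]_n) (s t : R) :
  S0^t* = - S0 -> S1^t* = - S1 -> H0^t* = H0 -> H1^t* = H1 ->
  0 < s -> (forall v : 'cV_(n * n + n * n),
     s * fronorm v <= fronorm (K1 F G *m v)) ->
  fronorm (col_mx S0 H0) <= t -> fronorm (col_mx S1 H1) <= t ->
  2 * t ^+ 2 < s ^+ 2 ->
  exists Y : 'M[C]_n,
    [/\ F *m Y - Y^t* *m F^t* = - S0 - Y^t* *m S1 *m Y,
        G *m Y + Y^t* *m G^t* = - H0 - Y^t* *m H1 *m Y &
        fronorm Y <= Num.sqrt 2 * t / s].
Proof.
move=> S0_skew S1_skew H0_herm H1_herm s0 K1_lb t_ge0 t_ge1 t_lt.
have t0 : 0 <= t := le_trans (fronorm_ge0 _) t_ge0.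
set r := _ / s; have r0 : 0 <= r.
  by rewrite !mulr_ge0 ?invr_ge0 ?sqrtr_ge0 // ltW.
have sqrt2 : Num.sqrt 2 ^+ 2 = 2 :> R by rewrite sqr_sqrtr.
have r2_lt1 : r ^+ 2 < 1.
  by rewrite /r !exprMn sqrt2 exprVn ltr_pdivrMr ?exprn_gt0 // mul1r.
pose k := Num.sqrt 2 * s.
have k0 : 0 < k by rewrite mulr_gt0 // sqrtr_gt0.
have kr : k * r = 2 * t.
  by rewrite /k /r -[in RHS]sqrt2; field; rewrite gt_eqF.
pose S (Y : 'M[C]_n) := - S0 - Y^t* *m S1 *m Y.
pose H (Y : 'M[C]_n) := - H0 - Y^t* *m H1 *m Y.
have [f f_sol] : exists f, forall Y,
    sylvester_pair F G (f Y) = col_mx (S Y) (H Y).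
  exists (fun Y => sylvester_pair_solve F G (S Y) (H Y)) => Y.
  apply: sylvester_pair_solveP; first exact: lower_bound_unitmx K1_lb.
    rewrite /S adjD !adjN !adjM trmxCK S0_skew S1_skew.
    by rewrite mulNmx mulmxN mulmxA opprD !opprK.
  by rewrite /H adjD !adjN !adjM trmxCK H0_herm H1_herm mulmxA.
have lb := sylvester_pair_lower_bound (ltW s0) K1_lb.
have sandwich (Y W : 'M[C]_n) :
    fronorm (col_mx (Y *m S1 *m W) (Y *m H1 *m W)) <=
    t * (fronorm Y * fronorm W).
  apply: le_trans (fronorm_sandwich Y S1 H1 W) _.
  by rewrite mulrAC mulrC ler_wpM2r // mulr_ge0 ?fronorm_ge0.
have f_ball Y : fronorm Y <= r -> fronorm (f Y) <= r.
  move=> Yr; rewrite -(ler_pM2l k0) kr; apply: le_trans (lb _) _.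
  have -> : sylvester_pair F G (f Y) =
    - col_mx S0 H0 - col_mx (Y^t* *m S1 *m Y) (Y^t* *m H1 *m Y).
    by rewrite f_sol !opp_col_mx add_col_mx.
  apply: le_trans (fronormB_le _ _) _; rewrite fronormN.
  have YY : fronorm (Y^t*) * fronorm Y <= 1.
    rewrite fronorm_adj; apply: le_trans (ltW r2_lt1).
    by rewrite ler_pM ?fronorm_ge0.
  have := sandwich (Y^t*) Y; have := ler_wpM2l t0 YY; lra.
have f_contr Y W : fronorm Y <= r -> fronorm W <= r ->
    fronorm (f Y - f W) <= r ^+ 2 * fronorm (Y - W).
  move=> Yr Wr; rewrite -(ler_pM2l k0); apply: le_trans (lb _) _.
  have -> : sylvester_pair F G (f Y - f W) =
    - col_mx (Y^t* *m S1 *m (Y - W)) (Y^t* *m H1 *m (Y - W))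
    - col_mx ((Y - W)^t* *m S1 *m W) ((Y - W)^t* *m H1 *m W).
    rewrite sylvester_pairB !f_sol 3!opp_col_mx 2!add_col_mx.
    by congr col_mx; apply: quadratic_diff.
  apply: le_trans (fronormB_le _ _) _; rewrite fronormN.
  have := sandwich (Y^t*) (Y - W); have := sandwich ((Y - W)^t*) W.
  rewrite !fronorm_adj.
  have := ler_wpM2r (fronorm_ge0 (Y - W)) Yr.
  have := ler_wpM2l (fronorm_ge0 (Y - W)) Wr.
  have -> : k * (r ^+ 2 * fronorm (Y - W)) = k * r * (r * fronorm (Y - W)).
    by ring.
  by rewrite kr => /(ler_wpM2l t0) ? /(ler_wpM2l t0) ?; lra.
have [|Y Yr YE] := contraction_fixpoint r0 _ f_ball f_contr.
  by rewrite sqr_ge0.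
have := f_sol Y; rewrite YE => /eq_col_mx[SE HE].
by exists Y; split; [exact: SE | exact: HE | exact: Yr].
Qed.

End SylvesterPair.

(** * The perturbed descriptor system *)

Theorem theorem2p1 (R : realType) (n m : nat)
    (E A : 'M[R[i]]_n) (B : 'M[R[i]]_(n, m)) (C : 'M[R[i]]_(m, n))
    (D : 'M[R[i]]_m)
    (DA11 DA12 DA22 DE11 DE12 DE22 : 'M[R[i]]_n)
    (EA_system : standing_assumptions E A B C D)
    (DA11_herm : DA11 \is hermsymmx) (DA22_herm : DA22 \is hermsymmx)
    (DE11_skew : DE11 \is skewhermmx) (DE22_skew : DE22 \is skewhermmx) :
  let AD := A + DA12 in
  let ED := E + DE12 in
  let delta := Num.min (sigma (2 * n ^ 2) (K1 ED AD))
                       (sigma (2 * n ^ 2) (K2 ED AD))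
               - 2 * Num.max (specnorm DA12) (specnorm DE12) in
  let theta := fronorm_seq [:: DE11; DE22; DA11; DA22] in
  let omega := Num.sqrt 2 * fronorm_seq [:: DA11; DA22; DE11; DE22] in
  0 < delta ->
  theta * omega / delta ^+ 2 < 1 / 4 ->
  exists Y12 Y21 : 'M[R[i]]_n,
    [/\ AD *m Y21 + Y21^t* *m AD^t* = - DA11 - Y21^t* *m DA22 *m Y21,
        ED *m Y21 - Y21^t* *m ED^t* = - DE11 - Y21^t* *m DE22 *m Y21,
        AD^t* *m Y12 + Y12^t* *m AD = - DA22 - Y12^t* *m DA11 *m Y12,
        - ED^t* *m Y12 + Y12^t* *m ED = - DE22 - Y12^t* *m DE11 *m Y12 &
        fronorm_seq [:: Y12; Y21] <= 2 * theta / delta].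
Proof.
have ge_min_l (x y : R) : Num.min x y <= x by rewrite ge_min lexx.
have ge_min_r (x y : R) : Num.min x y <= y by rewrite ge_min lexx orbT.
move=> AD ED delta theta omega delta_gt0 small.
have theta_ge0 : 0 <= theta := sqrtr_ge0 _.
have theta2 : theta ^+ 2 = fronorm DE11 ^+ 2 + fronorm DE22 ^+ 2
    + fronorm DA11 ^+ 2 + fronorm DA22 ^+ 2.
  rewrite sqr_sqrtr; first by rewrite !big_cons big_nil /=; ring.
  by apply: sumr_ge0 => M _; apply: sqr_ge0.
have omegaE : omega = Num.sqrt 2 * theta.
  by rewrite /omega /theta /fronorm_seq; congr (_ * Num.sqrt _);
    rewrite !big_cons !big_nil; ring.
have sqrt2_ge1 : 1 <= Num.sqrt 2 :> R.
  by rewrite -[leLHS]sqrtr1 ler_wsqrtr // ler1n.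
have theta_lt : 2 * theta ^+ 2 < delta ^+ 2.
  move: small; rewrite omegaE ltr_pdivrMr ?exprn_gt0 // mulrCA -expr2.
  have := sqr_ge0 theta; have := ler_wpM2r (sqr_ge0 theta) sqrt2_ge1.
  have : 0 < delta ^+ 2 by rewrite exprn_gt0.
  lra.
have delta_le M : Num.min (sigma (2 * n ^ 2) (K1 ED AD))
      (sigma (2 * n ^ 2) (K2 ED AD)) <= sigma (2 * n ^ 2) M ->
    forall v : 'cV_(n * n + n * n), delta * fronorm v <= fronorm (M *m v).
  move=> min_le v; apply: le_trans (sigma_last_mulmx M v).
  have : delta <= sigma (2 * n ^ 2) M.
    apply: le_trans min_le; rewrite /delta gerBl mulr_ge0 //.
    by rewrite le_max specnorm_ge0.
  by rewrite mul2n -addnn -mulnn => ?; rewrite ler_wpM2r ?fronorm_ge0.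
have K1_lb := delta_le (K1 ED AD) (ge_min_l _ _).
have K2_lb := delta_le (K2 ED AD) (ge_min_r _ _).
have skewP (M : 'M[R[i]]_n) : M \is skewhermmx -> M^t* = - M.
  by move/is_hermitianmxP; rewrite expr1 scaleN1r => {2}->; rewrite opprK.
have hermP (M : 'M[R[i]]_n) : M \is hermsymmx -> M^t* = M.
  by move/is_hermitianmxP; rewrite expr0 scale1r => {2}->.
have pair_le (M N : 'M[R[i]]_n) :
    fronorm M ^+ 2 + fronorm N ^+ 2 <= theta ^+ 2 ->
    fronorm (col_mx M N) <= theta.
  by move=> MN; apply: fronorm_sqr_le; rewrite ?sqr_fronorm_col_mx.
have sqs := (sqr_ge0 (fronorm DE11), sqr_ge0 (fronorm DE22),
  sqr_ge0 (fronorm DA11), sqr_ge0 (fronorm DA22)).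
have le1 : fronorm (col_mx DE11 DA11) <= theta.
  by apply: pair_le; rewrite theta2; move: sqs => [[[? ?] ?] ?]; lra.
have le2 : fronorm (col_mx DE22 DA22) <= theta.
  by apply: pair_le; rewrite theta2; move: sqs => [[[? ?] ?] ?]; lra.
have [Y21 [Y21_E Y21_A Y21_le]] := quadratic_pair_solution
  (skewP _ DE11_skew) (skewP _ DE22_skew)
  (hermP _ DA11_herm) (hermP _ DA22_herm)
  delta_gt0 K1_lb le1 le2 theta_lt.
rewrite K2_K1 in K2_lb.
have [Y12 [Y12_E Y12_A Y12_le]] := quadratic_pair_solution
  (skewP _ DE22_skew) (skewP _ DE11_skew)
  (hermP _ DA22_herm) (hermP _ DA11_herm)
  delta_gt0 K2_lb le2 le1 theta_lt.
exists Y12, Y21; split => //.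
- by rewrite -Y12_A trmxCK.
- by rewrite -Y12_E adjN trmxCK mulmxN opprK.
set r := _ / delta in Y21_le Y12_le.
have r_ge0 : 0 <= r := le_trans (fronorm_ge0 _) Y12_le.
(* The two solutions have norm at most [r = sqrt 2 * theta / delta], so their
   pair has norm at most [sqrt 2 * r]. *)
have r2 : r ^+ 2 + r ^+ 2 = (2 * theta / delta) ^+ 2.
  by rewrite /r !exprMn (@sqr_sqrtr _ 2) //; ring.
have bound_ge0 : 0 <= 2 * theta / delta by rewrite divr_ge0 ?mulr_ge0 // ltW.
have -> : 2 * theta / delta = Num.sqrt ((2 * theta / delta) ^+ 2).
  by rewrite sqrtr_sqr ger0_norm.
rewrite ler_wsqrtr // !big_cons big_nil addr0 -r2.
by rewrite lerD // ler_sqr ?nnegrE ?fronorm_ge0.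
Qed.
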